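(* Let $X$ be a Banach space and let $M$ be a bounded, closed and convex subset of $X$ containing the origin $0$ in its interior; put $\Omega=\mathrm{int}(M)$ (so $\overline{\Omega}=M$). Let $T:M\to M$ be a mapping (not necessarily continuous) such that $T(M)$ is a relatively compact subset of $X$ and $$\{x\}\cap\mathbb{T}x\subset\{Tx\}\quad\text{for every }x\in\overline{\Omega}\cap\mathbb{T}\,\overline{\Omega},$$ where $\mathbb{T}$ is the closed--convex envelope of $T$. Then $T$ has a fixed point in $M$.
   Context: The closed--convex envelope of $T:\overline{\Omega}\to X$ is the multivalued map $\mathbb{T}:\overline{\Omega}\to 2^X$, $\mathbb{T}x=\bigcap_{\varepsilon>0}\overline{\mathrm{co}}\,T(\overline{B}_\varepsilon(x)\cap\overline{\Omega})$, where $\overline{B}_\varepsilon(x)$ is the closed ball of center $x$ and radius $\varepsilon$ and $\overline{\mathrm{co}}$ denotes the closed convex hull; $\mathbb{T}\,\overline{\Omega}=\bigcup_{x\in\overline{\Omega}}\mathbb{T}x$. *)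

(* Defs.v *)
From HB Require Import structures.
From mathcomp Require Import all_boot all_order all_algebra.
From mathcomp Require Import all_classical all_reals all_analysis.

Set Implicit Arguments.
Unset Strict Implicit.
Unset Printing Implicit Defensive.

Import Order.TTheory GRing.Theory Num.Theory.
Import numFieldNormedType.Exports.

Local Open Scope classical_set_scope.
Local Open Scope ring_scope.

Definition closed_convex_hull (R : realType) (X : normedModType R)
    (A : set X) : set X :=
  smallest [set C : set X | closed C /\ convex_set C] A.

(* The envelope of a map defined on [closure Omega]. Although [T] is a total  *)
(* function here, only its values on [closure Omega] matter. For [0 < e],     *)
(* [closed_ball x e] is the set of the [y] with [`|x - y| <= e], by           *)
(* [closed_ballE].                                                            *)
Definition closed_convex_envelope (R : realType) (X : normedModType R)
    (Omega : set X) (T : X -> X) (x : X) : set X :=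
  \bigcap_(e in [set e : R | 0 < e])
    closed_convex_hull (T @` (closed_ball x e `&` closure Omega)).

(* Main.v *)
Require Import Defs.
From HB Require Import structures.
From mathcomp Require Import all_boot all_order all_algebra.
From mathcomp Require Import all_classical all_reals all_analysis.
From mathcomp Require Import ring lra.

(** If [x] lies in its own envelope then the hypothesis on the envelope gives
[T x = x], so everything reduces to finding such an [x].  The envelope of [T]
is a convex-valued map with closed graph, and the argument is Schauder's:
approximate by a continuous map of a finite-dimensional polytope, apply
Brouwer's theorem there, and pass to the limit.

Approximation ([approximate_fixed_point]).  Given [e > 0], take a finite
[e]-net [y_j] of [T(M)] and the sets [F_j] of those [x] in [M] for which [T x]
is [e]-close to [y_j]; they cover [M].  With [phi_j] a Lipschitz bump function
that is at least [e] on [F_j] and vanishes off its [e]-neighbourhood, the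
normalized [phi_j] are a Lipschitz map from [M] to a simplex, although [T] is
not continuous.  Composing with [w |-> \sum_j w_j y_j] gives a uniformly
continuous self-map of the simplex.  A nearly fixed [w] yields a point [x] of
the hull of [T(M)] that is [2e]-close to a convex combination of values [T z]
with [z] in [M] and [`|x - z| <= e].

Brouwer ([approximate_brouwer]).  Nearly fixed points come from a finite
combinatorial lemma of Scarf ([scarf], used through [no_bullying]): for
finitely many points, each ranked once for every colour, and any colouring of
the points, some set of points is dominant with respect to the colours
occurring on it.  On a fine grid of the simplex ranked by the coordinates, a
dominant set is a small cluster; colouring a grid point by a coordinate that
the map does not decrease makes that cluster nearly fixed.  Scarf's lemma is a
parity argument of Sperner's kind, but it replaces triangulations by orders.

Limit.  The closed convex hull of the relatively compact set [T(M)] is compact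
(Mazur, [compact_closed_convex_hull]), so the points [x] obtained for
[e = 1/(k+1)] have a cluster point, and every closed convex set containing
[T] of a ball around the cluster point contains it.  Finally the closure of
the interior of [M] is [M] ([closure_interior_convex]), so that the envelope
uses the values of [T] on all of [M]. *)

Set Implicit Arguments.
Unset Strict Implicit.
Unset Printing Implicit Defensive.

Import Order.TTheory GRing.Theory Num.Theory.
Import numFieldNormedType.Exports.

(** * Scarf's lemma on dominant sets *)

Section FiniteCombinatorics.

(* Classical sets share many lemma names with finite sets. *)
Import boot.fintype boot.finset.

Section Collision.
Variables (A B : finType) (f : A -> B) (S : {set B}).

(** A surjection onto a set with one element fewer than its source identifies
exactly one pair. *)
Lemma imset_collision : f @: [set: A] = S -> #|S|.+1 = #|A| ->
  exists i j, [/\ i != j, f i = f j &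
    forall k l, f k = f l -> k != l ->
      ((k == i) || (k == j)) && ((l == i) || (l == j))].
Proof.
move=> fS cS.
have [i [j [ij fij]]] : exists i j, i != j /\ f i = f j.
  have /injectivePn[i [j ij fij]] : ~~ injectiveb f; last by exists i, j.
  apply/negP => /injectiveP fi; move: cS.
  by rewrite -fS card_imset// cardsT => /eqP; rewrite eqn_leq ltnn.
exists i, j; split => //.
have inj_off a b : a != b -> f a = f b -> {in ~: [set a] &, injective f}.
  move=> ab fab; apply/imset_injP.
  have -> : f @: (~: [set a]) = S.
    apply/eqP; rewrite eqEsubset -fS imsetS ?subsetT//=.
    apply/subsetP => _ /imsetP[k _ ->].
    have [->|ka] := eqVneq k a; last by rewrite imset_f// !inE.
    by rewrite fab imset_f// !inE eq_sym.
  by rewrite cardsC1 -cS.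
move=> k l fkl kl.
have meets a b : a != b -> f a = f b -> (k == a) || (l == a).
  move=> ab fab; apply: contraNT kl; rewrite negb_or => /andP[ka la].
  by apply/eqP/(inj_off a b); rewrite ?inE.
have ji : j != i by rewrite eq_sym.
have := meets _ _ ij fij; have := meets _ _ ji (esym fij).
move=> + /orP[]/eqP H; rewrite H eqxx/= (negbTE ij) => /=.
  by move=> ->; rewrite orbT.
by rewrite orbF => ->; rewrite orbT.
Qed.
End Collision.

(** Each [r i] ranks [W] without ties.  Besides the proper points, [W] contains
one dummy [d i] for each colour [i], lying below everything in the ranking [i]
and above all proper points in the other rankings; the dummy [d i] has colour
[i].  A pair formed of a set of proper points and a set [C] of colours is
thereby encoded by a single subset of [W]: the points, and the dummies of the
colours outside [C].  Pivoting in such a pair, which either adds a point or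
removes a colour, becomes adding one element of [W]. *)
Section Scarf.
Variables (I W : finType) (r : I -> W -> nat) (d : I -> W) (c : W -> I).
Hypothesis r_inj : forall i, injective (r i).
Hypothesis d_min : forall i w, r i (d i) <= r i w.
Hypothesis d_max : forall i j w,
  i != j -> w \notin codom d -> r i w < r i (d j).
Hypothesis c_d : cancel d c.
Hypothesis I_gt1 : 1 < #|I|.
Variable w0 : W.
Hypothesis w0_proper : w0 \notin codom d.

Definition dominant (S : {set W}) :=
  [forall w, [exists i, [forall (s | s \in S), r i w <= r i s]]].

Lemma dominantP (S : {set W}) :
  reflect (forall w, exists i, forall s, s \in S -> r i w <= r i s)
    (dominant S).
Proof.
apply: (iffP forallP) => [H w|H w].
  by have /existsP[i /forall_inP Hi] := H w; exists i.
by have [i Hi] := H w; apply/existsP; exists i; apply/forall_inP.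
Qed.

Definition dummies := [set d i | i : I].

(** In the parity argument, a wall is a set with one element fewer than a room.
The set of all dummies is not dominant; counting it as a room nevertheless
leaves no boundary: every wall lies in an even number of rooms. *)
Definition room (A : {set W}) :=
  (#|A| == #|I|) && (dominant A || (A == dummies)).

Lemma mem_dummies w : (w \in dummies) = (w \in codom d).
Proof.
apply/imsetP/codomP => [[i _ ->]|[i ->]]; by exists i.
Qed.

Lemma card_dummies : #|dummies| = #|I|.
Proof. by rewrite card_imset//; exact: can_inj c_d. Qed.

Lemma even_of_two (s : {set W}) a b : a != b ->
  (forall x, (x \in s) = (x == a) || (x == b)) -> ~~ odd #|s|.
Proof.
move=> ab sE; have -> : s = [set a; b] by apply/setP => x; rewrite sE !inE.
by rewrite cards2 ab.
Qed.

(** The wall of all dummies but [d l] is shared by the set of all dummies and by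
the room obtained by adding the proper point ranked highest by [l]. *)
Lemma even_rooms_dummies l :
  ~~ odd #|[set a | (a \notin dummies :\ d l) && room (a |: (dummies :\ d l))]|.
Proof.
pose v := [arg max_(w > w0 | w \notin codom d) r l w].
have [v_proper v_max] : v \notin codom d /\
    forall w, w \notin codom d -> r l w <= r l v.
  by rewrite /v; case: arg_maxnP => // i ? ?; split.
have dl_D : d l \in dummies by rewrite mem_dummies codom_f.
apply: (@even_of_two _ (d l) v).
  by apply: contraNneq v_proper => <-; exact: codom_f.
move=> a; rewrite !inE negb_and negbK.
have [->|a_dl] /= := eqVneq a (d l).
  by rewrite /room setD1K// card_dummies !eqxx orbT.
have [->|a_v] /= := eqVneq a v.
  rewrite mem_dummies v_proper/= /room cardsU1
     !inE mem_dummies (negbTE v_proper) andbF/=.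
  rewrite -card_dummies (cardsD1 (d l) dummies) dl_D eqxx/=; apply/orP; left.
  apply/dominantP => w.
  have [/codomP[j ->]|w_proper] := boolP (w \in codom d); first by exists j.
  exists l => s /setU1P[->|]; first exact: v_max.
  rewrite !inE mem_dummies => /andP[s_dl /codomP[j sj]].
  rewrite sj ltnW// d_max//; apply: contraNneq s_dl => ->; by rewrite sj.
apply/negbTE; apply/negP => /andP[a_proper]; apply/negP.
rewrite /room negb_and negb_or; apply/orP; right; apply/andP; split; last first.
  by apply: contra a_proper => /eqP <-; rewrite !inE eqxx.
apply/negP => /dominantP /(_ v)[i iP].
have [il|il] := eqVneq i l.
  move: a_v; rewrite -il in v_max *; suff -> : a = v by rewrite eqxx.
  apply: (@r_inj i); apply/eqP; rewrite eqn_leq iP ?setU11// v_max//.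
  by rewrite -mem_dummies.
have : r i v <= r i (d i).
  apply: iP; rewrite !inE mem_dummies codom_f andbT (can_eq c_d) il.
  by rewrite orbT.
move=> /(conj (d_min i v)) /andP; rewrite -eqn_leq => /eqP /r_inj dv.
by move: v_proper; rewrite -dv codom_f.
Qed.

(** Sending a colour to the lowest element of [S] in its ranking is onto [S]
when [S] is dominant, so exactly two colours [i] and [j] share their lowest
element.  An element added to [S] has to become the lowest one for [i] or for
[j], and in either case it must be the highest candidate: two rooms. *)
Lemma even_rooms_proper (S : {set W}) :
  #|S|.+1 = #|I| -> ~~ (S \subset dummies) ->
  ~~ odd #|[set a | (a \notin S) && room (a |: S)]|.
Proof.
move=> cS /subsetPn[s0 s0S]; rewrite mem_dummies => s0_proper.
have roomE a : a \notin S -> room (a |: S) = dominant (a |: S).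
  move=> aS; rewrite /room cardsU1 aS add1n cS eqxx/=.
  rewrite (_ : _ == dummies = false) ?orbF//.
  by apply: contraNF s0_proper => /eqP H; rewrite -mem_dummies -H !inE s0S orbT.
have [->|/set0Pn[a0]] := eqVneq [set a | (a \notin S) && room (a |: S)] set0.
  by rewrite cards0.
rewrite inE => /andP[a0S]; rewrite roomE// => /dominantP dom0.
have domS w : exists i, forall s, s \in S -> r i w <= r i s.
  by have [i iP] := dom0 w; exists i => s sS; apply: iP; rewrite inE sS orbT.
pose mu i := [arg min_(s < s0 | s \in S) r i s].
have muS i : mu i \in S by rewrite /mu; case: arg_minnP.
have muP i s : s \in S -> r i (mu i) <= r i s.
  by rewrite /mu; case: arg_minnP => // ? _; exact.
have mu_eq i s : s \in S -> r i s <= r i (mu i) -> s = mu i.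
  by move=> sS si; apply: (@r_inj i); apply/eqP; rewrite eqn_leq si muP.
have mu_onto : mu @: [set: I] = S.
  apply/setP => s; apply/imsetP/idP => [[i _ ->]//|sS].
  by have [i iP] := domS s; exists i => //; apply: mu_eq => //; exact: iP.
have [i [j [ij mij pair]]] := imset_collision mu_onto cS.
(* The candidates that would become lowest at most in the ranking [k]. *)
pose M k v := [forall (l | l != k), r l (mu l) < r l v].
have MP k v : reflect (forall l, l != k -> r l (mu l) < r l v) (M k v).
  exact: forall_inP.
have Md k : M k (d k).
  apply/MP => l lk; apply: leq_ltn_trans (muP l s0 s0S) _.
  exact: d_max.
pose v k := [arg max_(w > d k | M k w) r k w].
have Mv k : M k (v k) by rewrite /v; case: arg_maxnP.
have v_max k w : M k w -> r k w <= r k (v k).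
  by rewrite /v; case: arg_maxnP => // ? _; exact.
have Mdom k w s : M k w -> s \in S -> r k w <= r k s.
  move=> /MP Mw sS; have [m mP] := domS w.
  have [<-|mk] := eqVneq m k; first exact: mP.
  by have := mP _ (muS m); rewrite leqNgt Mw.
have v_notin k k' : k != k' -> mu k = mu k' -> v k \notin S.
  move=> kk' mkk'; apply/negP; rewrite -{1}mu_onto => /imsetP[m _ vm].
  have /MP Mvk := Mv k.
  have [mk|mk] := eqVneq m k; last by have := Mvk _ mk; rewrite vm ltnn.
  by have := Mvk k'; rewrite eq_sym kk' vm mk mkk' ltnn => /(_ isT).
have v_dom k : dominant (v k |: S).
  apply/dominantP => w; have [Mw|] := boolP (M k w).
    by exists k => s /setU1P[->|sS]; [exact: v_max|exact: Mdom].
  rewrite negb_forall_in => /exists_inP[l lk]; rewrite -leqNgt => wl; exists l.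
  move=> s /setU1P[->|sS]; last exact: leq_trans wl (muP _ _ sS).
  by apply: leq_trans wl _; apply: ltnW; have /MP := Mv k; exact.
have vij : v i != v j.
  apply/eqP => vij; have /MP /(_ _ ij) := Mv j.
  by rewrite -vij ltnNge (Mdom i).
apply: even_of_two vij _ => a; rewrite inE.
apply/andP/orP => [[aS]|]; last first.
  move=> [] /eqP ->.
    by have vS := v_notin _ _ ij mij; rewrite roomE.
  have vS : v j \notin S by apply: (v_notin j i); rewrite // eq_sym.
  by rewrite roomE.
rewrite roomE// => /dominantP doma.
(* Each element of [a |: S] is lowest in some ranking; choosing one such ranking
   is injective, hence a bijection onto the colours. *)
pose e w : I := odflt (c w)
   [pick m | [forall (s | s \in a |: S), r m w <= r m s]].
have eP w s : s \in a |: S -> r (e w) w <= r (e w) s.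
  rewrite /e; case: pickP => [m /forall_inP|no]; first exact.
  have [m mP] := doma w; have /forall_inP[] := no m; exact: mP.
have e_inj : {in a |: S &, injective e}.
  move=> s t sS tS est; apply: (@r_inj (e s)); apply/eqP.
  by rewrite eqn_leq (eP s t)//= est (eP t s).
have e_onto l : exists2 s, s \in a |: S & e s = l.
  suff : l \in e @: (a |: S) by move=> /imsetP[s ? ->]; exists s.
  suff -> : e @: (a |: S) = [set: I] by rewrite inE.
  apply/eqP; rewrite eqEcard subsetT/= cardsT (card_in_imset e_inj).
  by rewrite cardsU1 aS add1n cS.
have e_mu l : l != e a -> e (mu l) = l /\ mu l != a.
  move=> la; have [s] := e_onto l; move=> /setU1P[->|sS] sl.
    by rewrite sl eqxx in la.
  suff <- : s = mu l by split=> //; apply: contraNneq aS => <-.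
  by apply: mu_eq => //; rewrite -sl; apply: eP; rewrite inE muS orbT.
have Ma : M (e a) a.
  apply/MP => l la; have [el mla] := e_mu l la.
  have := eP (mu l) a; rewrite el setU11 ltn_neqAle => -> //; rewrite andbT.
  by apply: contraNneq mla => /r_inj ->.
have ea : (e a == i) || (e a == j).
  apply: contraNT ij; rewrite negb_or ![e a == _]eq_sym => /andP[ia ja].
  have [ei _] := e_mu _ ia; have [ej _] := e_mu _ ja.
  by rewrite -ei -ej mij.
have av : a = v (e a).
  apply: (@r_inj (e a)); apply/eqP; rewrite eqn_leq v_max//=.
  have [m mP] := doma (v (e a)).
  have [mk|mk] := eqVneq m (e a).
    by move: mP; rewrite mk; apply; rewrite setU11.
  have /MP /(_ _ mk) := Mv (e a); rewrite ltnNge mP//.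
  by rewrite inE muS orbT.
by case/orP: ea => /eqP <-; rewrite -av eqxx; [left|right].
Qed.

Lemma even_rooms (S : {set W}) :
  ~~ odd #|[set a | (a \notin S) && room (a |: S)]|.
Proof.
have [->|/set0Pn[a]] := eqVneq [set a | (a \notin S) && room (a |: S)] set0.
  by rewrite cards0.
rewrite inE => /andP[aS /andP[/eqP + _]]; rewrite cardsU1 aS add1n => cS.
have [SD|] := boolP (S \subset dummies); last exact: even_rooms_proper.
have : #|dummies :\: S| == 1.
  by rewrite cardsD (setIidPr SD) card_dummies -cS subSnn.
move=> /cards1P[x xE]; have : x \in dummies :\: S by rewrite xE set11.
rewrite !inE => /andP[xS]; rewrite mem_dummies => /codomP[l xl].
suff -> : S = dummies :\ d l by exact: even_rooms_dummies.
rewrite -xl -xE setDDr setDv set0U; by apply/esym/setIidPr.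
Qed.

(** Sperner's count: call a wall of [A] a door if it carries all the colours but
[i0].  A room carrying all the colours has one door; a room carrying all the
colours but [i0] repeats one of them and has two; other rooms have none. *)
Lemma odd_doors (A : {set W}) i0 : #|A| = #|I| ->
  odd #|[set a in A | c @: (A :\ a) == ~: [set i0]]| = (c @: A == [set: I]).
Proof.
move=> cA; have [cAT|cAT] := boolP (c @: A == _).
  have c_inj : {in A &, injective c}.
    by apply/imset_injP; rewrite (eqP cAT) cardsT cA.
  have : i0 \in c @: A by rewrite (eqP cAT) inE.
  move=> /imsetP[a aA ia].
  rewrite (_ : [set _ in _ | _] = [set a]) ?cards1//.
  apply/setP => b; rewrite !inE; apply/andP/eqP => [[bA /eqP bE]|->].
    apply/eqP/contraT => ba.
    have : i0 \in c @: (A :\ b) by rewrite ia imset_f// !inE eq_sym ba.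
    by rewrite bE !inE eqxx.
  split => //; apply/eqP/setP => i; rewrite !inE ia; apply/imsetP/idP.
    move=> [x]; rewrite !inE => /andP[xa xA] ->.
    by apply: contra xa => /eqP /c_inj ->.
  have : i \in c @: A by rewrite (eqP cAT) inE.
  move=> /imsetP[x xA ->] xa; exists x => //; rewrite !inE xA andbT.
  by apply: contraNneq xa => ->.
apply/negbTE.
have [->|/set0Pn[a]] := eqVneq [set a in A | c @: (A :\ a) == ~: [set i0]] set0.
  by rewrite cards0.
rewrite inE => /andP[aA /eqP aE].
have c_inj : {in A :\ a &, injective c}.
  apply/imset_injP; rewrite aE cardsC1 -cA (cardsD1 a A) aA; exact: eqxx.
have ca : c a != i0.
  apply: contraNneq cAT => ca; rewrite eqEsubset subsetT/=.
  apply/subsetP => i _.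
  have [->|ii] := eqVneq i i0; first by rewrite -ca imset_f.
  have : i \in c @: (A :\ a) by rewrite aE !inE.
  by apply/subsetP/imsetS/subsetDl.
have : c a \in c @: (A :\ a) by rewrite aE !inE.
move=> /imsetP[b bAa cab].
have /andP[ba bA] : (b != a) && (b \in A) by rewrite !inE in bAa.
have abE : a != b by rewrite eq_sym.
apply: even_of_two abE _ => x; rewrite !inE.
have [->|xa] /= := eqVneq x a; first by rewrite aA aE eqxx.
have [->|xb] /= := eqVneq x b.
  rewrite bA/=; apply/eqP; rewrite -aE; apply/eqP; rewrite eqEsubset.
  apply/andP; split; apply/subsetP => z /imsetP[y];
    rewrite !inE => /andP[_ yA] ->{z}.
    have [->|ya] := eqVneq y a; first by rewrite cab imset_f.
    by rewrite imset_f// !inE ya.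
  have [->|yb] := eqVneq y b; first by rewrite -cab imset_f// !inE eq_sym ba.
  by rewrite imset_f// !inE yb.
apply/negP => /andP[xA /eqP xE].
have : c x \in c @: (A :\ x).
  by rewrite xE -aE imset_f// !inE xa.
move=> /imsetP[y]; rewrite !inE => /andP[yx yA] cxy.
have [ya|ya] := eqVneq y a.
  move: cxy; rewrite ya cab => /c_inj; rewrite !inE xa xA ba bA.
  move=> /(_ isT isT) xb'.
  by rewrite xb' eqxx in xb.
have xy : x = y by apply: c_inj; rewrite ?inE ?xa ?xA ?ya ?yA.
by rewrite xy eqxx in yx.
Qed.

(** Pairs of a room and one of its doors are counted in two ways.  Counting by
doors gives an even number, hence the number of rooms carrying all the colours
is even.  The set of all dummies is one of them, so there is another. *)
Lemma scarf : exists A, dominant A /\ c @: A = [set: I].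
Proof.
have [i0 _] : exists i0 : I, i0 \in I.
  by apply/card_gt0P; exact: ltnW.
pose dr (A : {set W}) := #|[set a in A | c @: (A :\ a) == ~: [set i0]]|.
have [/existsP[A /and3P[]]|] :=
  boolP [exists A, [&& room A, A != dummies & c @: A == [set: I]]].
  rewrite /room => /andP[_ /orP[]]; last by move=> ->.
  by move=> dA _ /eqP cA; exists A.
rewrite negb_exists => /forallP noA.
have odd_sum : odd (\sum_(A | room A) dr A).
  have rD : room dummies by rewrite /room card_dummies !eqxx orbT.
  rewrite (bigD1 dummies)//= oddD odd_doors ?card_dummies//.
  have -> : c @: dummies == setT.
    apply/eqP/setP => i; rewrite inE; apply/imsetP; exists (d i) => //.
    by rewrite imset_f.
  rewrite addTb; apply/negP => H.
  have : exists2 A, room A && (A != dummies) & odd (dr A).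
    apply/exists_inP; apply: contraLR H.
    rewrite negb_exists_in => /forall_inP H.
    by elim/big_rec: _ => // A n /H; rewrite oddD => /negbTE ->.
  move=> [A /andP[rA AD]]; rewrite odd_doors; last by case/andP: rA => /eqP.
  by move=> cA; have := noA A; rewrite rA AD cA.
suff sumE : \sum_(A | room A) dr A =
    \sum_(S : {set W} | c @: S == ~: [set i0])
      #|[set a | (a \notin S) && room (a |: S)]|.
  exfalso; move: odd_sum; rewrite sumE; apply/negP.
  elim/big_ind: _ => // [m n hm hn|S _]; last exact: even_rooms.
  by rewrite oddD (negbTE hm) (negbTE hn).
rewrite /dr; under eq_bigr do rewrite -sum1_card.
under [in RHS]eq_bigr do rewrite -sum1_card.
rewrite !pair_big_dep/=.
rewrite (reindex_onto (fun p : {set W} * W => (p.2 |: p.1, p.2))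
  (fun p => (p.1 :\ p.2, p.2)))/=.
  apply: eq_bigl => -[S a]/=; rewrite !inE eqxx/= xpair_eqE eqxx andbT.
  have [aS|aS] := boolP (a \in S).
    rewrite andbF; apply/negP => /andP[_ /eqP SE].
    by move: aS; rewrite -SE !inE eqxx.
  by rewrite setU1K// eqxx andbT andbC.
by move=> [A a]/=; rewrite !inE => /andP[_ /andP[aA _]]; rewrite setD1K.
Qed.
End Scarf.

(** Scarf's lemma without dummies and with ties allowed in the rankings.  The
name is that of the playful form of the lemma due to Petri and Voorneveld: no
[v] beats the weakest member of [S] in every colour occurring on [S]. *)
Lemma no_bullying (I V : finType) (f : V -> I -> nat) (c : V -> I) (v0 : V) :
  1 < #|I| ->
  exists2 S : {set V}, S != set0 &
    forall v, exists2 i, i \in c @: S & forall s, s \in S -> f v i <= f s i.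
Proof.
move=> I_gt1.
(* Ties are broken by the enumeration of [V]. *)
pose rk i v := f v i * #|V| + enum_rank v.
have rk_inj i : injective (rk i).
  move=> u v /(congr1 (modn^~ #|V|)); rewrite /rk !modnMDl !modn_small//.
  by move=> /val_inj /enum_rank_inj.
(* [B i] is above every proper rank; the ranks of the foreign dummies start
   there. *)
pose B i := \sum_v (rk i v).+1.
have rkB i v : rk i v < B i.
  by rewrite /B (bigD1 v)//= leq_addr.
pose r i (w : V + I) := match w with
  | inl v => (rk i v).+1
  | inr j => if j == i then 0 else (B i + enum_rank j).+1 end.
have codomE w : w \in codom (@inr V I) = if w is inr _ then true else false.
  case: w => [v|i]; last by rewrite codom_f.
  by apply/negP => /codomP[].
have [|||||A [/dominantP Adom Acol]] :=
  @scarf I (V + I)%type r inr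
    (fun w => match w with inl v => c v | inr i => i end)
    _ _ _ _ I_gt1 (inl v0) _.
- move=> i [u|j] [v|k] //=.
  + by move=> [] /rk_inj ->.
  + case: eqP => // _ [] H; by have := rkB i u; rewrite H ltnNge leq_addr.
  + case: eqP => // _ [] H; by have := rkB i v; rewrite -H ltnNge leq_addr.
  + do 2 case: eqP => //; first by move=> -> ->.
    by move=> _ _ [] /addnI /val_inj /enum_rank_inj ->.
- by move=> i w /=; rewrite eqxx.
- move=> i j [v|k] ij; rewrite codomE//= => _.
  by rewrite eq_sym (negbTE ij) ltnS (leq_trans (rkB _ _))// leq_addr.
- by [].
- by rewrite codomE.
have key v : exists i, [/\ i \in c @: [set v | inl v \in A] &
    forall s, inl s \in A -> f v i <= f s i].
  have [i iP] := Adom (inl v); exists i; split.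
    have : i \in [set: I] by rewrite inE.
    rewrite -Acol => /imsetP[[u|j]] uA iE; first by rewrite iE imset_f// inE.
    by have := iP _ uA; rewrite /= iE eqxx.
  move=> s /iP /=; rewrite ltnS /rk leqNgt => rks; rewrite leqNgt.
  apply: contra rks => fs; rewrite -addnS.
  apply: (@leq_trans ((f s i).+1 * #|V|)).
    by rewrite mulSn addnC leq_add2r ltn_ord.
  by rewrite (leq_trans (leq_mul fs (leqnn _)))// leq_addr.
exists [set v | inl v \in A].
  have [i [/imsetP[s sA _] _]] := key v0.
  by apply/set0Pn; exists s.
move=> v; have [i [iC iP]] := key v; exists i => // s; rewrite inE; exact: iP.
Qed.

(** * Approximate fixed points of self-maps of a simplex *)

Local Open Scope ring_scope.

Definition simplex (R : realFieldType) (I : finType) (x : I -> R) :=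
  (forall i, 0 <= x i) /\ \sum_i x i = 1.

(** Grid points [v], with coordinates [v_i / N], are coloured by a coordinate
[i] with [v_i <= g(v)_i], which exists as both sides sum to 1.  Let [S] be
dominant, [C] its set of colours and [m_i] the least [i]-th coordinate on [S].
A grid point above all the [m_i] for [i] in [C] is excluded, so these [m_i]
almost sum to the whole and [S] has small diameter.  Hence, at any point of
[S], [g] decreases no coordinate in [C] by much, and the coordinates outside
[C] are small already; as the coordinates sum to 1, none increases by much. *)
Lemma approximate_brouwer (R : archiRealFieldType) (I : finType)
    (g : (I -> R) -> I -> R) :
  (1 < #|I|)%N ->
  (forall x, simplex x -> simplex (g x)) ->
  (forall e, 0 < e -> exists2 delta, 0 < delta &
    forall x y, simplex x -> simplex y -> (forall i, `|x i - y i| <= delta) ->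
    forall i, `|g x i - g y i| <= e) ->
  forall e, 0 < e -> exists2 x, simplex x & forall i, `|g x i - x i| <= e.
Proof.
move=> I_gt1 g_simplex g_unif e e0.
have [i0 _] : exists i0 : I, i0 \in I by apply/card_gt0P; exact: ltnW.
have [n nE] : exists n, n = #|I| by exists #|I|.
have n0 : 0 < n%:R :> R by rewrite ltr0n nE ltnW.
pose eta := e / (n%:R *+ 2).
have eta0 : 0 < eta by rewrite divr_gt0// mulrn_wgt0.
have [delta delta0 g_close] := g_unif _ eta0.
pose rho := Num.min delta eta.
have rho0 : 0 < rho by rewrite lt_min delta0.
have [N N0 nN] : exists2 N, 0 < N%:R :> R & n%:R / N%:R <= rho.
  exists (Num.truncn (n%:R / rho)).+1; first by rewrite ltr0n.
  by rewrite ler_pdivrMr ?ltr0n// mulrC -ler_pdivrMr// ltW// truncnS_gt.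
pose V := {v : {ffun I -> 'I_N.+1} | (\sum_i v i == N)%N}.
pose coord (v : V) i : nat := val v i.
have coord_sum v : (\sum_i coord v i = N)%N by exact/eqP/(valP v).
have mkV (t : I -> nat) : (\sum_i t i = N)%N
    -> exists v : V, forall i, coord v i = t i.
  move=> tN; have tb i : (t i < N.+1)%N.
    by rewrite ltnS -tN (bigD1 i)//= leq_addr.
  pose w : {ffun I -> 'I_N.+1} := [ffun i => Ordinal (tb i)].
  have wP : (\sum_i w i == N)%N.
    by rewrite -[X in _ == X]tN; apply/eqP/eq_bigr => i _; rewrite ffunE.
  by exists (exist _ w wP) => i; rewrite /coord/= ffunE.
have [v0 _] : exists v : V, forall i, coord v i = if i == i0 then N else 0%N.
  by apply: mkV; rewrite -big_mkcond/= big_pred1_eq.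
pose pt v i : R := (coord v i)%:R / N%:R.
have pt_simplex v : simplex (pt v).
  split=> [i|]; first by rewrite divr_ge0.
  by rewrite -mulr_suml -natr_sum coord_sum divff// gt_eqF.
have colour v : exists i, pt v i <= g (pt v) i.
  apply/existsP; apply: contraT; rewrite negb_exists => /forallP H.
  have [_ s1] := g_simplex _ (pt_simplex v); have [_] := pt_simplex v.
  rewrite -s1 => s2.
  suff : \sum_i g (pt v) i < \sum_i pt v i by rewrite s2 ltxx.
  apply: ltr_sum => [|i _]; last by rewrite ltNge.
  by apply/hasP; exists i0; rewrite ?mem_index_enum.
pose c v := xchoose (colour v).
have cP v : pt v (c v) <= g (pt v) (c v) by exact: (xchooseP (colour v)).
have [S /set0Pn[s0 s0S] Sdom] := no_bullying coord c v0 I_gt1.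
pose C := c @: S.
have [m m_min m_att] : exists2 m : I -> nat,
    (forall i s, s \in S -> (m i <= coord s i)%N) &
    (forall i, exists2 s, s \in S & coord s i = m i).
  exists (fun i => coord [arg min_(s < s0 | s \in S) coord s i] i) => i.
    by move=> s sS; case: arg_minnP => // ? _; exact.
  by case: arg_minnP => // s sS _; exists s.
have m_sum : (N < \sum_(i in C) m i + n)%N.
  suff : (N < \sum_(i in C) (m i).+1)%N.
    move=> /leq_trans; apply; under eq_bigr do rewrite -addn1.
    by rewrite big_split/= leq_add2l sum1_card nE max_card.
  rewrite ltnNge; apply/negP => le.
  (* The point [t] is the least one above all the [m i]; what remains of the
     total [N] is put on one colour of [C]. *)
  pose K := (\sum_(i in C) (m i).+1)%N.
  have c0 : c s0 \in C by rewrite imset_f.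
  have [t tE] : exists t, forall i, coord t i =
      ((if i \in C then (m i).+1 else 0) + (if i == c s0 then N - K else 0))%N.
    apply: mkV; rewrite big_split/= -big_mkcond -[X in (_ + X)%N]big_mkcond/=.
    by rewrite big_pred1_eq subnKC.
  have [i iC iP] := Sdom t; have [s sS sm] := m_att i.
  by have := iP _ sS; rewrite tE iC sm addSn ltnNge leq_addr.
have m_in s i : s \in S -> i \in C -> (coord s i < m i + n)%N.
  move=> sS iC; rewrite -(ltn_add2r (\sum_(j in C | j != i) m j)) addnAC.
  move: m_sum; rewrite (bigD1 i)//=; apply: leq_ltn_trans.
  rewrite -(coord_sum s) [leqRHS](bigID (mem C))/=.
  rewrite [X in (_ <= X + _)%N](bigD1 i)//=.
  rewrite -addnA leq_add2l.
  by apply: leq_trans (leq_addr _ _); apply: leq_sum => j _; exact: m_min.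
have m_out s i : s \in S -> i \notin C -> (coord s i < n)%N.
  move=> sS iC; rewrite -(ltn_add2l (\sum_(j in C) m j)).
  apply: leq_ltn_trans m_sum.
  rewrite -(coord_sum s) [leqRHS](bigID (mem C))/= leq_add ?leq_sum//.
    by move=> j _; exact: m_min.
  by rewrite (bigD1 i)//= leq_addr.
have S_close s t i : s \in S -> t \in S -> pt s i <= pt t i + n%:R / N%:R.
  move=> sS tS; rewrite -mulrDl ler_pM2r ?invr_gt0// -natrD ler_nat.
  have [iC|iC] := boolP (i \in C).
    by rewrite (leq_trans (ltnW (m_in s i sS iC)))// leq_add2r m_min.
  by rewrite (leq_trans (ltnW (m_out s i sS iC)))// leq_addl.
exists (pt s0) => //.
have [x0 x1] := pt_simplex s0; have [y0 y1] := g_simplex _ (pt_simplex s0).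
have rho_eta : rho <= eta by rewrite ge_min lexx orbT.
have rho_delta : rho <= delta by rewrite ge_min lexx.
have lower i : pt s0 i - g (pt s0) i <= eta *+ 2.
  have [/imsetP[s sS iE]|iC] := boolP (i \in C).
    have close j : `|pt s0 j - pt s j| <= delta.
      rewrite ler_norml; have := S_close s0 s j s0S sS.
      have := S_close s s0 j sS s0S.
      lra.
    have := g_close _ _ (pt_simplex _) (pt_simplex _) close i.
    rewrite ler_norml; have := cP s; rewrite -iE.
    have := S_close s0 s i s0S sS; lra.
  have : pt s0 i <= n%:R / N%:R.
    by rewrite ler_pM2r ?invr_gt0// ler_nat ltnW// m_out.
  have := y0 i; lra.
have eta_e : n%:R * eta *+ 2 = e by rewrite /eta; field; rewrite gt_eqF.
have eta_le : eta *+ 2 <= e.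
  rewrite -eta_e ler_pMn2r//.
  by apply: ler_peMl; [exact: ltW|rewrite ler1n nE ltnW].
move=> i; rewrite ler_norml; apply/andP; split; last first.
  have : g (pt s0) i - pt s0 i = \sum_(j | j != i) (pt s0 j - g (pt s0) j).
    rewrite sumrB; move: x1 y1; rewrite (bigD1 i)//= => x1.
    rewrite (bigD1 i)//=.
    lra.
  move=> ->; apply: (@le_trans _ _ (\sum_(j | j != i) eta *+ 2)).
    by apply: ler_sum => j _.
  rewrite sumr_const -eta_e -mulrnAr.
  by rewrite -[X in X <= _]mulr_natl ler_pM2r ?mulrn_wgt0// ler_nat nE max_card.
have := lower i; lra.
Qed.

End FiniteCombinatorics.

(** * Convex sets and closed convex hulls *)

Local Open Scope classical_set_scope.
Local Open Scope ring_scope.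

Section Convex.
Variables (R : realType) (X : normedModType R).
Implicit Types (A C : set X) (x y : X).

Lemma closure_normP A x :
  closure A x <-> forall e : R, 0 < e -> exists2 y, A y & `|x - y| < e.
Proof.
split=> [clA e e0|H B /nbhs_ballP[e /= e0 eB]].
  have [y [Ay xy]] := clA _ (nbhsx_ballx x e e0).
  by exists y => //; move: xy; rewrite -ball_normE.
by have [y Ay xy] := H _ e0; exists y; split => //; apply: eB;
  rewrite -ball_normE.
Qed.

Lemma closed_normP C x : closed C ->
  (forall e : R, 0 < e -> exists2 y, C y & `|x - y| < e) -> C x.
Proof. by move=> cC H; apply: cC; apply/closure_normP. Qed.

Lemma convex_setP C : convex_set C <->
  forall x y (k : R), C x -> C y -> 0 <= k <= 1 -> C (k *: x + (1 - k) *: y).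
Proof.
split=> [cC x y k Cx Cy /andP[k0 k1]|cC x y k /set_mem Cx /set_mem Cy].
  have := cC x y (Itv01 k0 k1); rewrite !inE; exact.
by apply/mem_set; apply: cC => //; rewrite ge0 le1.
Qed.

(** Convexity is binary, so the sum is built up term by term; partial sums of
the weights are not 1, hence the induction on normalized partial sums. *)
Lemma convex_sum (I : finType) C (w : I -> R) (y : I -> X) :
  convex_set C -> simplex w -> (forall i, C (y i)) -> C (\sum_i w i *: y i).
Proof.
move=> /convex_setP cC [w0 w1] Cy.
suff H s : 0 < \sum_(i <- s) w i ->
    C ((\sum_(i <- s) w i)^-1 *: \sum_(i <- s) w i *: y i).
  by have := H (index_enum I); rewrite w1 invr1 scale1r; apply.
elim: s => [|i s IH]; first by rewrite big_nil ltxx.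
rewrite !big_cons => s0.
have t0 : 0 <= \sum_(j <- s) w j by apply: sumr_ge0.
have [tE|tN] := eqVneq (\sum_(j <- s) w j) 0.
  have wi0 : w i != 0 by move: s0; rewrite tE addr0 lt0r => /andP[].
  have -> : \sum_(j <- s) w j *: y j = 0.
    rewrite big_seq big1// => j js; move/eqP: tE.
    by rewrite psumr_eq0// => /allP /(_ j js) /eqP ->; rewrite scale0r.
  by rewrite tE !addr0 scalerA mulVf// scale1r.
set t := \sum_(j <- s) w j in t0 tN s0 IH *.
have tp : 0 < t by rewrite lt0r tN.
have -> : (w i + t)^-1 *: (w i *: y i + \sum_(j <- s) w j *: y j) =
    (w i / (w i + t)) *: y i +
    (1 - w i / (w i + t)) *: (t^-1 *: \sum_(j <- s) w j *: y j).
  rewrite scalerDr !scalerA; congr (_ *: _ + _ *: _); first by rewrite mulrC.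
  by field; rewrite tN gt_eqF.
apply: cC => //; first exact: IH.
by rewrite divr_ge0 ?(ltW s0)//= ler_pdivrMr// mul1r lerDl.
Qed.

Lemma closed_convex_hull_min A C : closed C -> convex_set C -> A `<=` C ->
  closed_convex_hull A `<=` C.
Proof. by move=> cC vC AC; exact: smallest_sub. Qed.

Lemma closed_closed_convex_hull A : closed (closed_convex_hull A).
Proof. by apply: closed_bigI => C [[]]. Qed.

Lemma convex_closed_convex_hull A : convex_set (closed_convex_hull A).
Proof.
apply/convex_setP => x y k Hx Hy k01 C CA; have [[_ /convex_setP vC] _] := CA.
by apply: vC => //; [exact: (Hx C CA)|exact: (Hy C CA)].
Qed.

Lemma sub_closed_convex_hull A : A `<=` closed_convex_hull A.
Proof. by move=> x Ax C [_]; apply. Qed.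

(** A point [x] of [C] is the limit of the points [(1 - k) x], around which a
ball centred at 0 and scaled by [k] fits inside [C]. *)
Lemma closure_interior_convex C : convex_set C -> C° 0 -> C `<=` closure C°.
Proof.
move=> /convex_setP cC /nbhs_ballP[r /= r0 rC] x Cx.
apply/closure_normP => e e0.
pose k := Num.min (e / (`|x| + 1) / 2) (1 / 2).
have x1 : 0 < `|x| + 1 by rewrite ltr_wpDl.
have k0 : 0 < k by rewrite lt_min !divr_gt0.
have k1 : k <= 1 by rewrite ge_min; apply/orP; right; lra.
exists ((1 - k) *: x).
  apply/nbhs_ballP; exists (k * r) => /=; first exact: mulr_gt0.
  move=> z; rewrite -ball_normE/= => xz.
  have -> : z = k *: (k^-1 *: (z - (1 - k) *: x)) + (1 - k) *: x.
    by rewrite scalerA divff ?gt_eqF// scale1r subrK.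
  apply: cC => //; last by rewrite ltW.
  apply: rC; rewrite -ball_normE/= sub0r normrN normrZ gtr0_norm ?invr_gt0//.
  by rewrite distrC mulrC ltr_pdivrMr// mulrC.
rewrite scalerBl scale1r opprB addrC subrK normrZ gtr0_norm//.
have ke : k <= e / (`|x| + 1) / 2 by rewrite ge_min lexx.
apply: (@le_lt_trans _ _ (e / (`|x| + 1) / 2 * (`|x| + 1))).
  by rewrite ler_pM// ?ltW// ?ltrDl ?lerDl.
by rewrite mulrAC divfK ?gt_eqF//; lra.
Qed.

Lemma compact_net A (e : R) : compact A -> 0 < e ->
  exists s : seq X, (forall y, y \in s -> A y) /\
    forall x, A x -> exists2 y, y \in s & `|x - y| < e.
Proof.
rewrite compact_cover => cA e0.
have [D DA Dcov] : finite_subset_cover A (fun x => ball x e) A.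
  apply: cA => [x _|x Ax]; first exact: ball_open.
  by exists x => //; exact: ballxx.
exists (finmap.enum_fset D); split=> [y yD|x /Dcov[y /= yD]].
  by apply: set_mem; apply: DA.
by rewrite -ball_normE/= distrC; exists y.
Qed.

(** The witness is the zonotope of the sums [\sum_i k_i y_i] with all [k_i] in
[0, 1].  Unlike the convex hull of [s], it is a segment added to the zonotope
of the tail, so compactness and convexity pass through the induction. *)
Lemma seq_sub_compact_convex (s : seq X) :
  exists P : set X,
    [/\ compact P, convex_set P, P 0 & forall y, y \in s -> P y].
Proof.
elim: s => [|y s [P [kP /convex_setP vP P0 sP]]].
  exists [set 0]; split => //; first exact: compact_set1.
  by apply/convex_setP => _ _ k -> ->; rewrite !scaler0 addr0.
pose f (p : R * X) : X := p.1 *: y + p.2.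
exists (f @` (`[0, 1] `*` P)); split.
- apply: continuous_compact; last first.
    by apply: compact_setX => //; exact: segment_compact.
  apply: continuous_subspaceT => p; apply: cvgD; last exact: cvg_snd.
  by apply: cvgZr_tmp; exact: cvg_fst.
- apply/convex_setP => _ _ k [[a p] [/= aI Pp] <-] [[b q] [/= bI Pq] <-] k01.
  exists (k * a + (1 - k) * b, k *: p + (1 - k) *: q) => /=.
    split; last exact: vP.
    move: aI bI k01; rewrite /= !in_itv/= => /andP[? ?] /andP[? ?] /andP[? ?].
    by apply/andP; split; nra.
  by rewrite /f/= scalerDl !scalerDr !scalerA addrACA.
- exists (0, 0); last by rewrite /f/= scale0r addr0.
  by split => //=; rewrite in_itv/= lexx ler01.
- move=> z; rewrite inE => /orP[/eqP ->|zs].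
    exists (1, 0); last by rewrite /f/= scale1r addr0.
    by split => //=; rewrite in_itv/= lexx ler01.
  exists (0, z); last by rewrite /f/= scale0r add0r.
  by split => /=; [rewrite in_itv/= lexx ler01|exact: sP].
Qed.

End Convex.

(** * Compactness of the closed convex hull *)

Section Mazur.
Variables (R : realType).

(** The points at distance at most [e] from [P], phrased without an infimum; the
slack [eta] makes the set closed whatever [P] is. *)
Definition thickening (X : normedModType R) (P : set X) (e : R) : set X :=
  [set x | forall eta : R, 0 < eta -> exists2 p, P p & `|x - p| < e + eta].

Lemma closed_thickening (X : normedModType R) (P : set X) (e : R) :
  closed (thickening P e).
Proof.
move=> x /closure_normP clx eta eta0 /=.
have eta2 : 0 < eta / 2 by rewrite divr_gt0.
have [y Qy xy] := clx _ eta2; have [p Pp yp] := Qy _ eta2; exists p => //.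
have := ler_distD y x p; lra.
Qed.

Lemma convex_thickening (X : normedModType R) (P : set X) (e : R) :
  convex_set P -> convex_set (thickening P e).
Proof.
move=> /convex_setP vP; apply/convex_setP => x y k /= Qx Qy k01 eta eta0.
have [p Pp xp] := Qx _ eta0; have [q Pq yq] := Qy _ eta0.
exists (k *: p + (1 - k) *: q); first exact: vP.
rewrite opprD addrACA -!scalerBr; apply: le_lt_trans (ler_normD _ _) _.
move: k01 => /andP[k0 k1]; rewrite !normrZ (ger0_norm k0) ger0_norm ?subr_ge0//.
have [->|kn0] := eqVneq k 0; first by rewrite mul0r add0r subr0 mul1r.
have : k * `|x - p| < k * (e + eta) by rewrite ltr_pM2l// lt0r kn0.
have : (1 - k) * `|y - q| <= (1 - k) * (e + eta).
  by rewrite ler_wpM2l ?subr_ge0// ltW.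
lra.
Qed.

(** An ultrafilter containing a finite union of small balls contains one of
them, so the ultrafilters on [K] are Cauchy. *)
Lemma compact_of_nets (X : completeNormedModType R) (K : set X) : closed K ->
  (forall e : R, 0 < e -> exists s : seq X,
    forall x, K x -> exists2 y, y \in s & `|x - y| < e) ->
  compact K.
Proof.
move=> cK nets; rewrite compact_ultra => F UF FK.
have cF : cauchy F.
  apply/cauchy_exP => e e0; have [s sP] := nets e e0.
  have {sP} : F (fun x => exists2 y, y \in s & `|x - y| < e).
    by apply: filterS FK.
  elim: s => [|y s IH] H.
    by exfalso; apply: (@filter_not_empty _ F _); apply: filterS H => x [].
  have [Fy|Fy] := in_ultra_setVsetC (ball y e) UF; first by exists y.
  apply: IH; apply: filterS2 H Fy => x [z]; rewrite inE => /orP[/eqP ->|zs xz].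
    by rewrite -ball_normE/= distrC.
  by exists z.
have /cauchy_cvg cvF := cF.
exists (lim F); split => //.
by apply: cK => B /cvF FB; exact: filter_ex (filterI FK FB).
Qed.

(** Mazur: [A] is within [e] of a compact convex set [P] containing a finite
net of [A].  The [e]-thickening of [P] is closed and convex, so it contains the
hull as well, and a net of [P] is then a coarser net of the hull. *)
Lemma compact_closed_convex_hull (X : completeNormedModType R) (A : set X) :
  precompact A -> compact (closed_convex_hull A).
Proof.
rewrite precompactE => kA; apply: compact_of_nets.
  exact: closed_closed_convex_hull.
move=> e e0; have e3 : 0 < e / 3 by rewrite divr_gt0.
have [s [_ sP]] := compact_net kA e3.
have [P [kP vP _ Ps]] := seq_sub_compact_convex s.
have [t [_ tP]] := compact_net kP e3; exists t => x Hx.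
have HQ := @closed_convex_hull_min _ _ A _ (@closed_thickening X P (e / 3))
  (@convex_thickening X P (e / 3) vP).
have [p Pp xp] : exists2 p, P p & `|x - p| < e / 3 + e / 3.
  apply: (HQ _ x Hx (e / 3) e3) => y Ay eta eta0 /=.
  have [z zs yz] := sP _ (subset_closure Ay); exists z; first exact: Ps.
  by rewrite (lt_trans yz)// ltrDl.
have [y yt py] := tP _ Pp; exists y => //.
have := ler_distD p x y; lra.
Qed.

End Mazur.

(** * Approximate fixed points of the envelope *)

Section ApproximateFixedPoint.
Variables (R : realType) (X : normedModType R).

(** The function is the positive part of [e] minus the distance to [F]. *)
Lemma lipschitz_bump (F : set X) (e : R) : F !=set0 -> 0 < e ->
  exists phi : X -> R, [/\ forall x, 0 <= phi x,
    forall x y, `|phi x - phi y| <= `|x - y|,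
    forall x, F x -> e <= phi x &
    forall x, 0 < phi x -> exists2 z, F z & `|x - z| < e].
Proof.
move=> [f0 Ff0] e0; pose D x : set R := [set `|x - z| | z in F].
have hD x : has_inf (D x).
  by split; [exists `|x - f0|, f0|exists 0 => _ [z _ <-]].
have lip x y : inf (D x) <= inf (D y) + `|x - y|.
  rewrite -lerBlDr; apply: lb_le_inf; first by exists `|y - f0|, f0.
  move=> _ [z Fz <-]; rewrite lerBlDr addrC.
  apply: le_trans (ler_distD y x z); apply: ge_inf; last by exists z.
  exact: (hD x).2.
exists (fun x => Num.max 0 (e - inf (D x))); split.
- by move=> x; rewrite le_max lexx.
- move=> x y; have := lip x y; have := lip y x; rewrite (distrC y) ler_norml.
  by rewrite /Num.max; do 2 case: ifP; lra.
- move=> x Fx; rewrite le_max; apply/orP; right; rewrite lerBrDr gerDl.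
  by apply: ge_inf; [exact: (hD x).2|exists x => //; rewrite subrr normr0].
- move=> x; rewrite lt_max ltxx/= => De.
  have [_ [z Fz <-] xz] := inf_adherent De (hD x).
  by exists z => //; rewrite -(subrKC (inf (D x)) e).
Qed.

(** The map [g] of the simplex sends [w] to the normalized bumps at the
barycentre [bary w]; at a nearly fixed [w], [bary w] is close to
[bary (g w)].  A weight [g w i] is nonzero only if some [z] near [bary w]
has [T z] close to [y i], and replacing [y i] by that [T z] gives [p]. *)
Lemma approximate_fixed_point (M : set X) (T : X -> X) (e : R) :
  closed M -> convex_set M -> M !=set0 -> set_fun M M T ->
  precompact (T @` M) ->
  0 < e -> exists x p, [/\ closed_convex_hull (T @` M) x,
    closed_convex_hull (T @` (closed_ball x e `&` M)) p & `|x - p| <= e *+ 2].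
Proof.
move=> cM vM [x0 Mx0] TM; rewrite precompactE => kT e0.
set H := closed_convex_hull (T @` M).
have cH : closed H by exact: closed_closed_convex_hull.
have vH : convex_set H by exact: convex_closed_convex_hull.
have HM : H `<=` M.
  by apply: closed_convex_hull_min => // _ [x Mx <-]; exact: TM.
have clT : closure (T @` M) `<=` H.
  move=> y cy; apply: cH; apply: closure_subset cy.
  exact: sub_closed_convex_hull.
have [s [sT sP]] := compact_net kT e0.
have [y0 y0s _] := sP _ (subset_closure (imageP T Mx0)).
(* Padding the net by [y0] gives the simplex at least two vertices. *)
pose I := 'I_(size s).+2.
pose y (i : I) := nth y0 s i.
have ys i : y i \in s.
  rewrite /y; have [lt|ge] := ltnP i (size s); first exact: mem_nth.
  by rewrite nth_default.
have yH i : H (y i) by apply: (clT); exact: sT (ys i).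
pose F (i : I) : set X := [set x | M x /\ `|T x - y i| < e].
have F0 i : F i !=set0.
  have /closure_normP /(_ e e0)[_ [x Mx <-] yx] := sT _ (ys i).
  by exists x; split => //; rewrite distrC.
have Fcov x : M x -> exists i, F i x.
  move=> Mx; have [z zs xz] := sP _ (subset_closure (imageP T Mx)).
  have zi : (index z s < (size s).+2)%N by rewrite ltnS leqW// index_size.
  by exists (Ordinal zi); split => //; rewrite /y/= nth_index.
have /choice[phi phiP] : forall i, exists phi : X -> R,
    [/\ forall x, 0 <= phi x,
    forall x y, `|phi x - phi y| <= `|x - y|,
    forall x, F i x -> e <= phi x &
    forall x, 0 < phi x -> exists2 z, F i z & `|x - z| < e].
  by move=> i; exact: lipschitz_bump.
have phi0 i x : 0 <= phi i x by case: (phiP i).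
have phiL i x x' : `|phi i x - phi i x'| <= `|x - x'| by case: (phiP i).
pose Phi x := \sum_i phi i x.
have Phi_e x : M x -> e <= Phi x.
  move=> /Fcov[i Fi]; rewrite /Phi (bigD1 i)//= ler_wpDr ?sumr_ge0//.
  by case: (phiP i) => _ _ + _; exact.
pose bary (w : I -> R) : X := \sum_i w i *: y i.
have baryH w : simplex w -> H (bary w) by move=> sw; exact: convex_sum.
pose B := \sum_i `|y i|.
have B0 : 0 <= B by rewrite sumr_ge0.
have bary_close w w' (c : R) : (forall i, `|w i - w' i| <= c) ->
    `|bary w - bary w'| <= c * B.
  move=> ww'; rewrite /bary -sumrB mulr_sumr.
  apply: le_trans (ler_norm_sum _ _ _) _.
  by apply: ler_sum => i _; rewrite -scalerBl normrZ ler_wpM2r.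
pose g (w : I -> R) i := phi i (bary w) / Phi (bary w).
have g_simplex w : simplex w -> simplex (g w).
  move=> sw; have := Phi_e _ (HM _ (baryH _ sw)) => Pe.
  have P0 : 0 < Phi (bary w) by exact: lt_le_trans Pe.
  split=> [i|]; first by rewrite divr_ge0// ltW.
  by rewrite -mulr_suml divff// gt_eqF.
pose n : R := #|I|%:R.
have n1 : 0 < 1 + n by rewrite ltr_pwDl// ler0n.
have g_lip w w' i : simplex w -> simplex w' ->
    `|g w i - g w' i| <= (1 + n) * `|bary w - bary w'| / e.
  move=> sw sw'; set x := bary w; set x' := bary w'; set D := `|x - x'|.
  have [s0 s1] := g_simplex _ sw'.
  have Pe : e <= Phi x by exact: Phi_e (HM _ (baryH _ _)).
  have P0 : 0 < Phi x by exact: lt_le_trans Pe.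
  have P'0 : 0 < Phi x'.
    by apply: lt_le_trans e0 _; exact: Phi_e (HM _ (baryH _ _)).
  have PL : `|Phi x' - Phi x| <= n * D.
    rewrite /Phi -sumrB; apply: le_trans (ler_norm_sum _ _ _) _.
    rewrite mulr_natl -sumr_const; apply: ler_sum => j _.
    by rewrite /D distrC.
  have -> : g w i - g w' i =
      ((phi i x - phi i x') + g w' i * (Phi x' - Phi x)) / Phi x.
    by rewrite /g -/x -/x'; field; rewrite !gt_eqF.
  rewrite normrM normfV (gtr0_norm P0) ler_pdivrMr//.
  apply: (@le_trans _ _ ((1 + n) * D)); last first.
    by rewrite mulrAC ler_pdivlMr// ler_wpM2l//;
      exact: mulr_ge0 (ltW n1) (normr_ge0 _).
  apply: le_trans (ler_normD _ _) _; rewrite mulrDl mul1r lerD//.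
  rewrite normrM ger0_norm//; apply: le_trans PL.
  rewrite ler_piMl// -s1 (bigD1 i)//= lerDl sumr_ge0// => j _; exact: s0.
have g_unif : forall r : R, 0 < r -> exists2 delta, 0 < delta &
    forall x x', simplex x -> simplex x' ->
    (forall i, `|x i - x' i| <= delta) ->
    forall i, `|g x i - g x' i| <= r.
  move=> r r0; have C0 : 0 < (1 + n) * (B + 1) by rewrite mulr_gt0// ltr_wpDl.
  exists (r * e / ((1 + n) * (B + 1))); first by rewrite divr_gt0// mulr_gt0.
  move=> w w' sw sw' ww' i; apply: le_trans (g_lip _ _ _ sw sw') _.
  rewrite ler_pdivrMr//.
  apply: (@le_trans _ _ ((1 + n) * (r * e / ((1 + n) * (B + 1)) * (B + 1)))).
    rewrite ler_wpM2l ?(ltW n1)//; apply: le_trans (bary_close _ _ _ ww') _.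
    by rewrite ler_wpM2l ?lerDl// divr_ge0 ?mulr_ge0 ?addr_ge0
      ?(ltW n1) ?(ltW r0) ?(ltW e0).
  rewrite le_eqVlt; apply/orP; left; apply/eqP; field.
  by rewrite !gt_eqF// ltr_wpDl.
have I_gt1 : (1 < #|I|)%N by rewrite card_ord.
have r0 : 0 < e / (B + 1) by rewrite divr_gt0// ltr_wpDl.
have [w sw wP] := approximate_brouwer I_gt1 g_simplex g_unif r0.
set x := bary w; have Mx : M x by exact: HM (baryH _ _).
have [gw0 gw1] := g_simplex _ sw.
have /choice[q qP] : forall i, exists q, (T @` (closed_ball x e `&` M)) q /\
    g w i * `|y i - q| <= g w i * e.
  move=> i; have [gi0|gi0] := eqVneq (g w i) 0.
    (* A vertex of weight zero only needs some value of [T] near [x]. *)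
    exists (T x); rewrite gi0 !mul0r; split => //.
    by exists x => //; split => //; exact: closed_ballxx.
  have : 0 < phi i x.
    rewrite lt0r phi0 andbT; apply: contraNneq gi0 => p0.
    by rewrite /g -/x p0 mul0r.
  case: (phiP i) => _ _ _ /[apply] -[z [Mz Tz] xz].
  exists (T z); split; last by rewrite ler_wpM2l// distrC ltW.
  by exists z => //; split => //; rewrite closed_ballE//= /closed_ball_/= ltW.
exists x, (\sum_i g w i *: q i); split; first exact: baryH.
  apply: convex_sum; [exact: convex_closed_convex_hull|exact: g_simplex|].
  by move=> i; apply: sub_closed_convex_hull; case: (qP i).
apply: le_trans (ler_distD (bary (g w)) _ _) _; rewrite mulr2n lerD//.
  apply: (@le_trans _ _ (e / (B + 1) * B)).
    by apply: bary_close => i; rewrite distrC.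
  by rewrite mulrAC ler_pdivrMr ?ltr_wpDl// ler_wpM2l ?lerDl// ltW.
rewrite /bary -sumrB; apply: le_trans (ler_norm_sum _ _ _) _.
rewrite -[leRHS]mul1r -gw1 mulr_suml; apply: ler_sum => i _.
by rewrite -scalerBr normrZ ger0_norm//; case: (qP i).
Qed.

End ApproximateFixedPoint.

(** * The fixed point *)

Theorem theorem4p1 (R : realType) (X : completeNormedModType R)
    (M : set X) (T : X -> X)
    (M_bounded : bounded_set M)
    (M_closed : closed M)
    (M_convex : convex_set M)
    (M_int0 : M° 0)
    (T_stable : set_fun M M T)
    (TM_relcompact : precompact (T @` M))
    (T_envelope : forall x : X,
      (closure M° `&`
        \bigcup_(y in closure M°) closed_convex_envelope M° T y) x ->
      [set x] `&` closed_convex_envelope M° T x `<=` [set T x]) :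
  exists2 x : X, M x & T x = x.
Proof.
have Mcl : closure M° = M.
  apply/seteqP; split; last exact: closure_interior_convex.
  move=> x clx; apply: M_closed; apply: closure_subset clx.
  exact: interior_subset.
have M0 : M !=set0 by exists 0; exact: interior_subset.
have pos (k : nat) : 0 < k.+1%:R^-1 :> R by rewrite invr_gt0 ltr0n.
have /choice[u /choice[p uP]] : forall k : nat, exists x p,
    [/\ closed_convex_hull (T @` M) x,
      closed_convex_hull (T @` (closed_ball x k.+1%:R^-1 `&` M)) p &
      `|x - p| <= k.+1%:R^-1 *+ 2].
  by move=> k; exact: approximate_fixed_point.
have [x [Hx clx]] : closed_convex_hull (T @` M) `&` cluster (u @ \oo) !=set0.
  apply: (compact_closed_convex_hull TM_relcompact).
  by exists 0 => // k _; case: (uP k).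
have Mx : M x.
  apply: (closed_convex_hull_min _ _ _ Hx) => // _ [z Mz <-].
  exact: T_stable.
(* The envelope has closed graph: a ball around [x] contains the smaller balls
   around the [u k] close to [x], so [p k], which is close to [x], lies in any
   closed convex [C] containing the values of [T] on the former. *)
have xE : closed_convex_envelope M° T x x.
  move=> e /= e0; rewrite Mcl => C [[cC vC] TC].
  apply: (closed_normP cC) => r r0.
  have [d d0 [de dr]] : exists2 d : R, 0 < d & d * 4 <= e /\ d * 4 <= r.
    exists (Num.min e r / 4); first by rewrite divr_gt0// lt_min e0.
    by rewrite divfK// !ge_min !lexx orbT.
  have near_small : \forall k \near \oo, k.+1%:R^-1 < d :> R.
    exact: near_infty_natSinv_lt (PosNum d0).
  have tail : (u @ \oo) [set u k | k in [set k | k.+1%:R^-1 < d :> R]].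
    by apply: filterS near_small => k kd; exists k.
  have [_ [[k /= kd <-]]] := clx _ _ tail (nbhsx_ballx x d d0).
  rewrite -ball_normE/= => xu; have [_ pk up] := uP k; exists (p k).
    apply: (closed_convex_hull_min cC vC _ pk) => _ [z [uz Mz] <-].
    apply: TC; exists z => //; split => //.
    move: uz; rewrite !closed_ballE// /closed_ball_/= => uz.
    have uzd := le_lt_trans uz kd.
    have := ler_distD (u k) x z; lra.
  have upd : `|u k - p k| <= d *+ 2.
    by apply: le_trans up _; rewrite ler_pMn2r// ltW.
  have := ler_distD (u k) x (p k); lra.
exists x => //; apply/esym/(T_envelope x); last by [].
by rewrite Mcl; split => //; exists x.
Qed.
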